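(* Let $\mathbb{I}$ be a consistent interval which is a bounded distributive lattice satisfying the disjunction property and the Phoa principle, equipped with an internal sum structure that factors binary meets. Then a type $X$ is based Segal complete if and only if $L(X)$ is based Segal complete.
   Context: Homotopy type theory. An interval is a set $\mathbb{I}$ with bounded meet-semilattice structure $(0,1,\sqcap)$, $i\sqsubseteq j$ meaning $i\sqcap j=i$; $[\![i]\!]:\equiv(i=1)$. Consistent: $0\ne1$. Bounded distributive lattice: $\mathbb{I}$ also has binary joins $\sqcup$ making it a bounded distributive lattice; disjunction property: $[\![i\sqcup j]\!]\leftrightarrow[\![i]\!]\lor[\![j]\!]$. Phoa principle: every $\alpha\colon\mathbb{I}\to\mathbb{I}$ is monotone, and $\alpha,\beta\colon\mathbb{I}\to\mathbb{I}$ agreeing at $0$ and $1$ are equal. $L(X):\equiv\sum_{i:\mathbb{I}}X^{[\![i]\!]}$. An internal sum structure is a function $\Sigma\colon L(\mathbb{I})\to\mathbb{I}$ such that the square with top $\{(1,\lambda\_.1)\}\to\{1\}$, left $\{(1,\lambda\_.1)\}\hookrightarrow L(\mathbb{I})$, right $\{1\}\hookrightarrow\mathbb{I}$ and bottom $\Sigma$ is a pullback; it factors binary meets if $\Sigma(i,\lambda\_.j)=i\sqcap j$. $\mathbb{I}/j:\equiv\{i\mid i\sqsubseteq j\}$. The join $P*X$ is the pushout of $P\leftarrow P\times X\to X$; the Sierpiński cone of $X$ is $X_\bot:\equiv\sum_{i:\mathbb{I}}(i=0)*X$; $[\![j]\!]_\bot$ is the Sierpiński cone of the proposition $[\![j]\!]$,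 $\simeq\{i\mid i=0\lor j=1\}$, included in $\mathbb{I}/j$ by $i\mapsto i$. A type $Y$ is based Segal complete if for every $j:\mathbb{I}$ the restriction map $Y^{\mathbb{I}/j}\to Y^{[\![j]\!]_\bot}$ is an equivalence. *)

(* Defs.v *)
(** Synthetic homotopy theory, with Rocq's own type theory as the ambient
    dependent type theory.  Identity types are Rocq's inductive [=]; neither
    uniqueness of identity proofs nor any other axiom is assumed, so an arbitrary
    [X : Type] need not be a set.  What plain type theory lacks (function
    extensionality, pushouts, propositional truncations) is given by the
    hypotheses [funext], [pushouts] and [truncations] below.

    The axioms of classical logic and choice refute the Phoa principle for
    a consistent interval, and proof irrelevance makes every type a set; neither
    is compatible with the intended reading. *)

(** * Homotopy type theory *)

Definition is_contr (A : Type) : Type := {c : A & forall x : A, c = x}.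

Definition is_prop (A : Type) : Type := forall x y : A, x = y.

Definition is_set (A : Type) : Type := forall x y : A, is_prop (x = y).

Definition fiber {A B : Type} (f : A -> B) (b : B) : Type := {a : A & f a = b}.

Definition is_equiv {A B : Type} (f : A -> B) : Type :=
  forall b : B, is_contr (fiber f b).

Definition logically_equivalent (A B : Type) : Type := (A -> B) * (B -> A).

Notation "A <~> B" := (logically_equivalent A B) (at level 95, no associativity)
  : type_scope.

Definition happly {A : Type} {B : A -> Type} (f g : forall a, B a) (p : f = g) :
    forall a, f a = g a :=
  fun a => f_equal (fun h : forall a, B a => h a) p.

Definition funext : Type :=
  forall (A : Type) (B : A -> Type) (f g : forall a, B a), is_equiv (happly f g).

Definition is_pullback {A B C D : Type} (top : A -> B) (left : A -> C)
    (right : B -> D) (bottom : C -> D)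
    (comm : forall a, right (top a) = bottom (left a)) : Type :=
  is_equiv (fun a : A =>
    existT (fun b : B => {c : C & right b = bottom c}) (top a)
      (existT (fun c : C => right (top a) = bottom c) (left a) (comm a))).

Definition cocone {A B C : Type} (f : A -> B) (g : A -> C) (Z : Type) : Type :=
  {l : B -> Z & {r : C -> Z & forall a, l (f a) = r (g a)}}.

Record pushout {A B C : Type} (f : A -> B) (g : A -> C) : Type := Pushout {
  po_type :> Type;
  po_inl : B -> po_type;
  po_inr : C -> po_type;
  po_glue : forall a, po_inl (f a) = po_inr (g a);
  po_universal : forall Z : Type,
    is_equiv (fun h : po_type -> Z =>
      existT (fun l : B -> Z => {r : C -> Z & forall a, l (f a) = r (g a)})
        (fun b => h (po_inl b))
        (existT (fun r : C -> Z => forall a, h (po_inl (f a)) = r (g a))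
          (fun c => h (po_inr c))
          (fun a => f_equal h (po_glue a))) : cocone f g Z)
}.

Definition pushouts : Type :=
  forall (A B C : Type) (f : A -> B) (g : A -> C), pushout f g.

Definition po_rec {A B C : Type} {f : A -> B} {g : A -> C} (P : pushout f g)
    (Z : Type) (c : cocone f g Z) : P -> Z :=
  projT1 (projT1 (po_universal f g P Z c)).

Record truncation (A : Type) : Type := Truncation {
  tr_type :> Type;
  tr : A -> tr_type;
  tr_is_prop : is_prop tr_type;
  tr_rec : forall Q : Type, is_prop Q -> (A -> Q) -> tr_type -> Q
}.

Definition truncations : Type := forall A : Type, truncation A.

Definition disjunction (T : truncations) (P Q : Type) : Type := T (P + Q)%type.

Definition join (po : pushouts) (P X : Type) : Type :=
  po (P * X)%type P X fst snd.

(** * Intervals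

    The order structures of the standard libraries come with decidable or
    choice-equipped carriers, which no consistent interval satisfying the Phoa
    principle can have; hence these records. *)

Record interval : Type := Interval {
  I_type :> Type;
  I_is_set : is_set I_type;
  I0 : I_type;
  I1 : I_type;
  meet : I_type -> I_type -> I_type;
  meetA : forall i j k, meet i (meet j k) = meet (meet i j) k;
  meetC : forall i j, meet i j = meet j i;
  meetI : forall i, meet i i = i;
  meet1 : forall i, meet I1 i = i;
  meet0 : forall i, meet I0 i = I0
}.

Arguments I0 {_}.
Arguments I1 {_}.
Arguments meet {_} _ _.

Definition le {I : interval} (i j : I) : Prop := meet i j = i.

Definition holds {I : interval} (i : I) : Prop := i = I1.

Definition consistent (I : interval) : Prop := I0 <> I1 :> I.

(** Absorption makes [sup] the binary join for [le], so that [I0] and [I1] are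
    its unit and its absorbing element. *)
Record distributive_lattice (I : interval) : Type := DistributiveLattice {
  sup : I -> I -> I;
  supA : forall i j k, sup i (sup j k) = sup (sup i j) k;
  supC : forall i j, sup i j = sup j i;
  supI : forall i, sup i i = i;
  supK : forall i j, sup i (meet i j) = i;
  meetK : forall i j, meet i (sup i j) = i;
  meet_supDr : forall i j k, meet i (sup j k) = sup (meet i j) (meet i k)
}.

Arguments sup {_} _ _ _.

Definition disjunction_property (T : truncations) {I : interval}
    (D : distributive_lattice I) : Type :=
  forall i j : I, holds (sup D i j) <~> disjunction T (holds i) (holds j).

Definition phoa_principle (I : interval) : Prop :=
  (forall (a : I -> I) (i j : I), le i j -> le (a i) (a j)) /\
  (forall a b : I -> I, a I0 = b I0 -> a I1 = b I1 -> a = b).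

Definition L (I : interval) (X : Type) : Type := {i : I & holds i -> X}.

Definition L_top (I : interval) : L I I :=
  existT (fun i : I => holds i -> I) I1 (fun _ => I1).

(** A singleton subset is presented as the map from [unit] that picks out its
    element. *)
Record internal_sum (I : interval) : Type := InternalSum {
  Sigma :> L I I -> I;
  Sigma_top : I1 = Sigma (L_top I);
  Sigma_pullback :
    is_pullback (fun x : unit => x) (fun _ : unit => L_top I)
      (fun _ : unit => I1) Sigma (fun _ => Sigma_top)
}.

Definition factors_binary_meets {I : interval} (S : internal_sum I) : Prop :=
  forall i j : I, S (existT (fun i : I => holds i -> I) i (fun _ => j)) = meet i j.

(** * Based Segal completeness *)

Definition slice {I : interval} (j : I) : Type := {i : I & le i j}.

Definition sierpinski_cone (po : pushouts) (I : interval) (X : Type) : Type :=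
  {i : I & join po (i = I0) X}.

Lemma le_I0 {I : interval} (i j : I) : i = I0 -> le i j.
Proof. intros e; rewrite e; apply meet0. Defined.

Lemma le_I1 {I : interval} (i j : I) : holds j -> le i j.
Proof. unfold holds, le; intros e; rewrite e, meetC; apply meet1. Defined.

Definition cone_le (po : pushouts) {I : interval} (i j : I) :
    join po (i = I0) (holds j) -> le i j :=
  po_rec (po _ _ _ fst snd) (le i j)
    (existT _ (le_I0 i j)
      (existT _ (le_I1 i j) (fun _ => I_is_set I _ _ _ _))).

Definition cone_to_slice (po : pushouts) {I : interval} (j : I)
    (x : sierpinski_cone po I (holds j)) : slice j :=
  existT (fun i : I => le i j) (projT1 x) (cone_le po (projT1 x) j (projT2 x)).

Definition based_segal_complete (po : pushouts) (I : interval) (Y : Type) : Type :=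
  forall j : I,
    is_equiv (fun (f : slice j -> Y) (x : sierpinski_cone po I (holds j)) =>
      f (cone_to_slice po j x)).

(* Main.v *)
Require Import Defs.

(** Based Segal completeness says that maps extend uniquely along the inclusion of
    the cone of [j] in the slice below [j].  The interval itself has this property:
    by the Phoa principle a map [f] on the slice is [i |-> sup (f 0) (meet i (f j))],
    and only [meet j (f j)] matters, which [S] recovers from the partial value of [f]
    at [j].  Since [L I X] is the sum of the types [holds i -> X], it is then complete
    iff, for every [f : slice j -> I], unique extension holds for the family
    [holds (f b) -> X].  The constant family [f = I1] gives one direction.
    Conversely [holds (f b)] means [f 0 = 1] or [b = f j = 1] by the disjunction property;
    in the first case this is unique extension for [X], in the second [b] lies in
    the cone already, and a fracture square glues the two. *)

(** * Contractible types and equivalences *)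

Definition transport {A : Type} (B : A -> Type) {x y : A} (p : x = y) : B x -> B y :=
  match p with eq_refl => fun b => b end.

Lemma contr_is_prop {A : Type} : is_contr A -> is_prop A.
Proof. intros [c H] x y; exact (eq_trans (eq_sym (H x)) (H y)). Qed.

(** The path is corrected so that it is reflexivity when the endpoints agree. *)
Definition prop_path {A : Type} (H : is_prop A) (x y : A) : x = y :=
  eq_trans (eq_sym (H x x)) (H x y).

Lemma prop_path_refl {A : Type} (H : is_prop A) (x : A) : prop_path H x x = eq_refl.
Proof. unfold prop_path; destruct (H x x); reflexivity. Qed.

Lemma prop_is_set {A : Type} : is_prop A -> is_set A.
Proof.
  intros H x y.
  assert (K : forall p : x = y, p = prop_path H x y).
  { intros p; destruct p; symmetry; apply prop_path_refl. }
  intros p q; rewrite (K p); symmetry; apply K.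
Qed.

(** Quasi-inverse data: it transfers contractibility and composes by plain rewriting; [iso_is_equiv]
    and [equiv_iso] pass to and from contractible fibres. *)
Record iso (A B : Type) : Type := Iso {
  to : A -> B;
  from : B -> A;
  fromK : forall a, from (to a) = a;
  toK : forall b, to (from b) = b
}.

Arguments Iso {A B} _ _ _ _.
Arguments to {A B} _ _.
Arguments from {A B} _ _.
Arguments fromK {A B} _ _.
Arguments toK {A B} _ _.

Definition iso_sym {A B : Type} (e : iso A B) : iso B A :=
  Iso (from e) (to e) (toK e) (fromK e).

Definition iso_trans {A B C : Type} (e : iso A B) (e' : iso B C) : iso A C.
Proof.
  refine (Iso (fun a => to e' (to e a)) (fun c => from e (from e' c)) _ _).
  - intros a; rewrite (fromK e'); apply fromK.
  - intros c; rewrite (toK e); apply toK.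
Defined.

Lemma contr_iso {A B : Type} (e : iso A B) : is_contr A -> is_contr B.
Proof.
  intros [c H]; exists (to e c); intros b; rewrite (H (from e b)); apply toK.
Qed.

Lemma equiv_iso {A B : Type} {f : A -> B} : is_equiv f -> iso A B.
Proof.
  intros H; refine (Iso f (fun b => projT1 (projT1 (H b))) _ _).
  - intros a; exact (f_equal (@projT1 _ _) (projT2 (H (f a)) (existT _ a eq_refl))).
  - intros b; exact (projT2 (projT1 (H b))).
Defined.

(** The fibre of [f] over [b] is a retract of the fibre of [f \o g], and the latter
    of the singleton at [b]; no adjoint correction of the homotopies is needed. *)
Lemma iso_is_equiv {A B : Type} (f : A -> B) (g : B -> A)
    (gf : forall a, g (f a) = a) (fg : forall b, f (g b) = b) : is_equiv f.
Proof.
  intros b; exists (existT _ (g b) (fg b)); intros [a p].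
  pose (u := fun w : fiber (fun b' => f (g b')) b =>
    existT (fun a => f a = b) (g (projT1 w)) (projT2 w)).
  pose (v := fun x : {b' : B & b' = b} =>
    existT (fun b' => f (g b') = b) (projT1 x) (eq_trans (fg (projT1 x)) (projT2 x))).
  assert (lift_path : forall x a (e : x = a) (p : f a = b),
    existT (fun a => f a = b) x (eq_trans (f_equal f e) p) = existT _ a p).
  { intros x a' e p'; destruct e; cbn; rewrite eq_trans_refl_l; reflexivity. }
  assert (Hu : forall a p, u (existT _ (f a) (eq_trans (f_equal f (gf a)) p))
                           = existT (fun a => f a = b) a p).
  { intros a' p'; apply lift_path. }
  assert (Hv : forall b' q, v (existT _ b' (eq_trans (eq_sym (fg b')) q))
                           = existT (fun b' => f (g b') = b) b' q).
  { intros b' q; unfold v; cbn; destruct q; destruct (fg b'); reflexivity. }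
  rewrite <- (Hu a p), <- Hv.
  change (existT _ (g b) (fg b)) with (u (v (existT _ b eq_refl))).
  generalize (eq_trans (eq_sym (fg (f a))) (eq_trans (f_equal f (gf a)) p)).
  generalize (f a); intros b' q; destruct q; reflexivity.
Qed.

Lemma is_equiv_postcompose {A B C : Type} (e : iso B C) (f : A -> B) :
  is_equiv (fun a => to e (f a)) <~> is_equiv f.
Proof.
  split; intros H; pose (k := equiv_iso H).
  - apply (iso_is_equiv f (fun b => from k (to e b))).
    + exact (fromK k).
    + intros b; exact (eq_trans (eq_sym (fromK e _))
        (eq_trans (f_equal (from e) (toK k (to e b))) (fromK e b))).
  - apply (iso_is_equiv _ (fun c => from k (from e c))).
    + intros a; rewrite (fromK e); apply (fromK k).
    + intros c; transitivity (to e (from e c)); [apply f_equal, (toK k) | apply toK].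
Qed.

(** * Isomorphisms of dependent sums and products *)

Definition iso_sigma {A : Type} {B C : A -> Type} (e : forall a, iso (B a) (C a)) :
  iso {a : A & B a} {a : A & C a}.
Proof.
  refine (Iso (fun w => existT C (projT1 w) (to (e _) (projT2 w)))
              (fun w => existT B (projT1 w) (from (e _) (projT2 w))) _ _).
  - intros [a b]; cbn; apply f_equal, fromK.
  - intros [a c]; cbn; apply f_equal, toK.
Defined.

Definition iso_sigma_swap {A B : Type} (C : A -> B -> Type) :
  iso {a : A & {b : B & C a b}} {b : B & {a : A & C a b}}.
Proof.
  unshelve refine (Iso _ _ _ _).
  - intros [a [b c]]; exact (existT _ b (existT _ a c)).
  - intros [b [a c]]; exact (existT _ a (existT _ b c)).
  - intros [a [b c]]; reflexivity.
  - intros [b [a c]]; reflexivity.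
Defined.

Definition iso_sigma_interchange {A : Type} (B C : A -> Type) (D : forall a, B a -> C a -> Type) :
  iso {w : {a : A & B a} & {c : C (projT1 w) & D (projT1 w) (projT2 w) c}}
      {w : {a : A & C a} & {b : B (projT1 w) & D (projT1 w) b (projT2 w)}}.
Proof.
  unshelve refine (Iso _ _ _ _).
  - intros [[a b] [c d]]; exact (existT _ (existT _ a c) (existT _ b d)).
  - intros [[a c] [b d]]; exact (existT _ (existT _ a b) (existT _ c d)).
  - intros [[a b] [c d]]; reflexivity.
  - intros [[a c] [b d]]; reflexivity.
Defined.

(** Transport uses the corrected [prop_path], which is reflexivity at [a]; this gives the second
    round trip. *)
Definition iso_sigma_contr {A : Type} (B : A -> Type) (H : is_contr A) (a : A) :
  iso {x : A & B x} (B a).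
Proof.
  pose (P := contr_is_prop H).
  refine (Iso (fun w => transport B (prop_path P (projT1 w) a) (projT2 w))
              (fun b => existT B a b) _ _).
  - intros [x b]; cbn; destruct (prop_path P x a); reflexivity.
  - intros b; cbn; rewrite prop_path_refl; reflexivity.
Defined.

Definition iso_path_sigma {A : Type} (B : A -> Type) (w w' : {a : A & B a}) :
  iso (w = w')
      {p : projT1 w = projT1 w' & transport B p (projT2 w) = projT2 w'}.
Proof.
  unshelve refine (Iso _ _ _ _).
  - intros e; destruct e; exact (existT _ eq_refl eq_refl).
  - destruct w as [a b], w' as [a' b']; cbn; intros [p q]; destruct p; cbn in q; destruct q;
      reflexivity.
  - intros e; destruct e, w; reflexivity.
  - destruct w as [a b], w' as [a' b']; cbn; intros [p q]; destruct p; cbn in q; destruct q;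
      reflexivity.
Defined.

Definition iso_pi_flip {A B : Type} (C : A -> B -> Type) :
  iso (forall a b, C a b) (forall b a, C a b) :=
  Iso (fun f b a => f a b) (fun f a b => f b a) (fun _ => eq_refl) (fun _ => eq_refl).

(** * Consequences of function extensionality *)

Section FunctionExtensionality.

Context (fe : funext).

Definition iso_happly {A : Type} {B : A -> Type} (f g : forall a, B a) :
  iso (f = g) (forall a, f a = g a) := equiv_iso (fe A B f g).

Definition ext {A : Type} {B : A -> Type} {f g : forall a, B a} :
  (forall a, f a = g a) -> f = g := from (iso_happly f g).

Definition iso_pi {A : Type} {B C : A -> Type} (e : forall a, iso (B a) (C a)) :
  iso (forall a, B a) (forall a, C a).
Proof.
  refine (Iso (fun f a => to (e a) (f a)) (fun f a => from (e a) (f a)) _ _);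
    intros f; apply ext; intros a; [apply fromK | apply toK].
Defined.

Definition iso_choice {A : Type} {B : A -> Type} (C : forall a, B a -> Type) :
  iso (forall a, {b : B a & C a b}) {f : forall a, B a & forall a, C a (f a)}.
Proof.
  refine (Iso
    (fun s => existT (fun f => forall a, C a (f a))
       (fun a => projT1 (s a)) (fun a => projT2 (s a)))
    (fun w a => existT (C a) (projT1 w a) (projT2 w a)) _ _).
  - intros s; apply ext; intros a; cbn; destruct (s a); reflexivity.
  - intros [f c]; reflexivity.
Defined.

Definition iso_curry {A B : Type} (C : A * B -> Type) :
  iso (forall x, C x) (forall a b, C (a, b)).
Proof.
  refine (Iso (fun f a b => f (a, b))
    (fun f x => match x with (a, b) => f a b end) _ _).
  - intros f; apply ext; intros [a b]; reflexivity.
  - reflexivity.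
Defined.

Definition iso_eval {A : Type} (B : A -> Type) (H : is_prop A) (a : A) :
  iso (forall x, B x) (B a).
Proof.
  refine (Iso (fun f => f a) (fun b x => transport B (prop_path H a x) b) _ _).
  - intros f; apply ext; intros x; destruct (prop_path H a x); reflexivity.
  - intros b; rewrite prop_path_refl; reflexivity.
Defined.

Lemma contr_pi {A : Type} {B : A -> Type} :
  (forall a, is_contr (B a)) -> is_contr (forall a, B a).
Proof.
  intros H; exists (fun a => projT1 (H a)); intros f; apply ext; intros a; apply (projT2 (H a)).
Qed.

Lemma prop_pi {A : Type} {B : A -> Type} :
  (forall a, is_prop (B a)) -> is_prop (forall a, B a).
Proof. intros H f g; apply ext; intros a; apply H. Qed.

(** Once the centres are identified, the two contractions are families of paths in a set. *)
Lemma is_contr_is_prop (A : Type) : is_prop (is_contr A).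
Proof.
  intros [c H] [c' H']; destruct (H c'); apply f_equal, ext; intros x.
  apply prop_is_set, contr_is_prop; exact (existT _ c H).
Qed.

Lemma is_equiv_is_prop {A B : Type} (f : A -> B) : is_prop (is_equiv f).
Proof. apply prop_pi; intros b; apply is_contr_is_prop. Qed.

Lemma prop_from_contr {A : Type} : (A -> is_contr A) -> is_prop A.
Proof. intros H x; exact (contr_is_prop (H x) x). Qed.

Lemma contr_based_paths_to {A : Type} (a : A) : is_contr {x : A & x = a}.
Proof.
  unshelve eexists; [exact (existT _ a eq_refl)|].
  intros [x p]; destruct p; reflexivity.
Qed.

Lemma contr_based_paths_from {A : Type} (a : A) : is_contr {x : A & a = x}.
Proof.
  unshelve eexists; [exact (existT _ a eq_refl)|].
  intros [x p]; destruct p; reflexivity.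
Qed.

(** * Joins of propositions *)

Lemma sigma_eq_contr {A : Type} {B : A -> Type} (H : forall a, is_contr (B a))
    (w w' : {a : A & B a}) : projT1 w = projT1 w' -> w = w'.
Proof.
  destruct w as [a b], w' as [a' b']; cbn; intros p; destruct p.
  apply f_equal, contr_is_prop, H.
Qed.

(** With [l] fixed, the rest of a cocone is a choice, for each [q], of a point [y] with paths
    [l p = y] for all [p]. As [P] is contractible, this is a based path space. *)
Lemma cocone_eq_l {P Q Z : Type} (p : P) (HP : is_prop P)
    (c c' : cocone (@fst P Q) (@snd P Q) Z) : projT1 c = projT1 c' -> c = c'.
Proof.
  apply sigma_eq_contr; intros l.
  refine (contr_iso (iso_sigma (fun r => iso_sym (iso_trans
    (iso_curry (fun a => l (fst a) = r (snd a))) (iso_pi_flip (fun p q => l p = r q))))) _).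
  refine (contr_iso (iso_choice (fun q y => forall p, l p = y)) (contr_pi _)); intros q.
  exact (contr_iso (iso_sigma (fun y => iso_sym (iso_eval _ HP p))) (contr_based_paths_from (l p))).
Qed.

Lemma cocone_eq_r {P Q Z : Type} (q : Q) (HQ : is_prop Q)
    (c c' : cocone (@fst P Q) (@snd P Q) Z) :
  projT1 (projT2 c) = projT1 (projT2 c') -> c = c'.
Proof.
  intros H; rewrite <- (fromK (iso_sigma_swap _) c), <- (fromK (iso_sigma_swap _) c').
  apply f_equal, sigma_eq_contr.
  2: destruct c as [? []], c' as [? []]; exact H.
  intros r; refine (contr_iso (iso_sigma (fun l =>
    iso_sym (iso_curry (fun a => l (fst a) = r (snd a))))) _).
  refine (contr_iso (iso_choice (fun p y => forall q, y = r q)) (contr_pi _)); intros p.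
  exact (contr_iso (iso_sigma (fun y => iso_sym (iso_eval _ HQ q))) (contr_based_paths_to (r q))).
Qed.

Section Join.

Context (po : pushouts) {P Q : Type} (HP : is_prop P) (HQ : is_prop Q).

Definition join_inl : P -> join po P Q := po_inl _ _ (po (P * Q)%type P Q fst snd).
Definition join_inr : Q -> join po P Q := po_inr _ _ (po (P * Q)%type P Q fst snd).

Definition join_maps (Z : Type) : iso (join po P Q -> Z) (cocone fst snd Z) :=
  equiv_iso (po_universal _ _ (po (P * Q)%type P Q fst snd) Z).

(** The identity and the constant map at [join_inl p] have equal left legs, hence equal cocones, so
    the universal property identifies them. *)
Lemma join_contr_l : P -> is_contr (join po P Q).
Proof.
  intros p; exists (join_inl p); intros x.
  refine (happly (fun _ => join_inl p) (fun x => x) _ x).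
  rewrite <- (fromK (join_maps _) (fun _ => join_inl p)), <- (fromK (join_maps _) (fun x => x)).
  apply f_equal, (cocone_eq_l p HP); apply ext; intros p'; cbn.
  destruct (HP p p'); reflexivity.
Qed.

Lemma join_contr_r : Q -> is_contr (join po P Q).
Proof.
  intros q; exists (join_inr q); intros x.
  refine (happly (fun _ => join_inr q) (fun x => x) _ x).
  rewrite <- (fromK (join_maps _) (fun _ => join_inr q)), <- (fromK (join_maps _) (fun x => x)).
  apply f_equal, (cocone_eq_r q HQ); apply ext; intros q'; cbn.
  destruct (HQ q q'); reflexivity.
Qed.

(** A point of the join may be assumed; contractibility is a proposition, so the two legs
    suffice. *)
Lemma join_is_prop : is_prop (join po P Q).
Proof.
  apply prop_from_contr, po_rec.
  exact (existT _ join_contr_l (existT _ join_contr_r (fun _ => is_contr_is_prop _ _ _))).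
Qed.

Lemma join_rec_prop (Z : Type) : is_prop Z -> (P -> Z) -> (Q -> Z) -> join po P Q -> Z.
Proof.
  intros HZ l r; apply po_rec; exact (existT _ l (existT _ r (fun _ => HZ _ _))).
Qed.

End Join.

(** * Unique extensions *)

(** Unique extendability along the projection [{b : B & P b} -> B], stated pointwise:
    a section of this product is an extension of [h]. *)
Definition unique_extensions {B : Type} (P Y : B -> Type) : Type :=
  forall h : (forall b, P b -> Y b), is_contr (forall b, {y : Y b & forall p, y = h b p}).

(** By function extensionality and choice, the fibre of restriction over [h] is the product of
    pointwise extensions. *)
Lemma is_equiv_unique_extensions {B : Type} (P : B -> Type) (Y : B -> Type) :
  is_equiv (fun (g : forall b, Y b) b (_ : P b) => g b) <~> unique_extensions P Y.
Proof.
  assert (e : forall h : (forall b, P b -> Y b),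
    iso (fiber (fun (g : forall b, Y b) b (_ : P b) => g b) h)
        (forall b, {y : Y b & forall p, y = h b p})).
  { intros h; refine (iso_trans (iso_sigma (fun g => _)) (iso_sym (iso_choice _))).
    exact (iso_trans (iso_happly _ _) (iso_pi (fun b => iso_happly _ _))). }
  split; intros H h; [exact (contr_iso (e h) (H h)) | exact (contr_iso (iso_sym (e h)) (H h))].
Qed.

Lemma existT_transport {A : Type} (B : A -> Type) (w : {a : A & B a}) (a : A)
    (p : a = projT1 w) : existT B a (transport B (eq_sym p) (projT2 w)) = w.
Proof. destruct w as [a' b]; cbn in *; destruct p; reflexivity. Qed.

(** Extending a partial section of pairs means extending its first component, which is possible in
    exactly one way, and then the second component over the result. *)
Lemma unique_extensions_sigma {B : Type} {P : B -> Type} {Y : B -> Type}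
    (Z : forall b, Y b -> Type) (HY : unique_extensions P Y) :
  unique_extensions P (fun b => {y : Y b & Z b y})
  <~> (forall f : (forall b, Y b), unique_extensions P (fun b => Z b (f b))).
Proof.
  assert (e : forall (f : forall b, Y b) (k : forall b, P b -> Z b (f b)),
    iso (forall b, {w : {y : Y b & Z b y} & forall p, w = existT _ (f b) (k b p)})
        (forall b, {z : Z b (f b) & forall p, z = k b p})).
  { intros f k.
    refine (iso_trans (iso_pi (fun b => iso_trans _
      (iso_sigma_interchange (Z b) (fun y => P b -> y = f b)
         (fun y z E => forall p, transport (Z b) (E p) z = k b p)))) _).
    { exact (iso_sigma (fun w => iso_trans
        (iso_pi (fun p => iso_path_sigma (Z b) w (existT _ (f b) (k b p))))
        (iso_choice (fun p E => transport (Z b) E (projT2 w) = k b p)))). }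
    refine (iso_trans (iso_choice
      (fun b (w : {y : Y b & P b -> y = f b}) =>
      {z : Z b (projT1 w) & forall p, transport (Z b) (projT2 w p) z = k b p})) _).
    (* The extensions of the restriction of [f] form a contractible type, so they may be contracted
       onto [f] itself. *)
    exact (iso_sigma_contr _ (HY (fun b _ => f b)) (fun b => existT _ (f b) (fun _ => eq_refl))). }
  split; intros H.
  - intros f k; exact (contr_iso (e f k) (H _)).
  - intros h; pose (s := projT1 (HY (fun b p => projT1 (h b p)))).
    (* The second components of [h] are moved over the extended first component [s]. *)
    pose (k := fun b p => transport (Z b) (eq_sym (projT2 (s b) p)) (projT2 (h b p))).
    assert (E : (fun b p => existT (Z b) (projT1 (s b)) (k b p)) = h).
    { apply ext; intros b; apply ext; intros p; apply existT_transport. }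
    rewrite <- E; exact (contr_iso (iso_sym (e _ k)) (H _ k)).
Qed.

(** If [R] holds, evaluation is an inverse; if [F] is contractible, so is [R -> F]. Being an
    equivalence is a proposition, so the truncation can be eliminated. *)
Lemma constant_equiv {R F : Type} (HR : is_prop R) (T : truncations) :
  T (R + is_contr F)%type -> is_equiv (fun (x : F) (_ : R) => x).
Proof.
  apply tr_rec; [apply is_equiv_is_prop|]; intros [r | H].
  - apply (iso_is_equiv _ (fun k => k r)); [reflexivity|].
    intros k; apply ext; intros r'; destruct (HR r r'); reflexivity.
  - assert (H' : is_contr (R -> F)) by exact (contr_pi (fun _ => H)).
    apply (iso_is_equiv _ (fun _ => projT1 H)).
    + apply (projT2 H).
    + intros k; apply (contr_is_prop H').
Qed.

Definition iso_extension_exp {P Q X : Type} (h : P -> Q -> X) :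
  iso {z : Q -> X & forall p, z = h p} (forall q, {x : X & forall p, x = h p q}).
Proof.
  refine (iso_trans (iso_sigma (fun z => _)) (iso_sym (iso_choice _))).
  exact (iso_trans (iso_pi (fun p => iso_happly _ _)) (iso_pi_flip _)).
Defined.

(** Fracture argument: given [q : Q b], the type of values extending [h] at [b] is
    contractible as soon as [P b] is, so it always agrees with its power by [R];
    hence so does the type of all extensions, which is contractible under [R]. *)
Lemma unique_extensions_exp {B : Type} {P Q : B -> Type} {R X : Type} (T : truncations)
    (HR : is_prop R) (HQ : forall b, is_prop (Q b)) (RQ : R -> forall b, Q b)
    (QRP : forall b, Q b -> T (R + is_contr (P b))%type)
    (HX : unique_extensions P (fun _ => X)) :
  unique_extensions P (fun b => Q b -> X).
Proof.
  intros h.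
  refine (contr_iso (iso_sym (iso_pi (fun b => iso_extension_exp (h b)))) _).
  pose (C := forall b (q : Q b), {x : X & forall p, x = h b p q}); change (is_contr C).
  assert (e : iso C (R -> C)).
  { refine (iso_trans _ (iso_pi_flip _)); apply iso_pi; intros b.
    refine (iso_trans _ (iso_pi_flip _)); apply iso_pi; intros q.
    eapply equiv_iso, (constant_equiv HR T).
    apply (tr_rec _ (T _) _ (tr_is_prop _ _)) with (2 := QRP b q).
    intros [r | H]; apply tr; [left; exact r | right].
    refine (contr_iso (iso_sigma (fun x =>
      iso_sym (iso_eval _ (contr_is_prop H) (projT1 H)))) (contr_based_paths_to _)). }
  refine (contr_iso (iso_sym e) (contr_pi (fun r => _))).
  (* Under [r] every [Q b] is inhabited, so evaluating at [RQ r b] leaves extensions of an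
     [X]-valued partial map. *)
  exact (contr_iso (iso_pi (fun b => iso_sym (iso_eval _ (HQ b) (RQ r b))))
    (HX (fun b p => h b p (RQ r b)))).
Qed.

Lemma unique_extensions_contr_exp {B : Type} {P : B -> Type} {Q X : Type} (HQ : is_prop Q) (q : Q) :
  unique_extensions P (fun _ => Q -> X) -> unique_extensions P (fun _ => X).
Proof.
  intros H h.
  refine (contr_iso (iso_pi (fun b => iso_trans
    (iso_extension_exp (fun p (_ : Q) => h b p)) (iso_eval _ HQ q))) (H _)).
Qed.

(** * Based Segal completeness *)

Section Interval.

Context (po : pushouts) {I : interval}.

Definition in_cone (j : I) (b : slice j) : Type := join po (projT1 b = I0) (holds j).

Lemma le_is_prop (i j : I) : is_prop (le i j).
Proof. apply I_is_set. Qed.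

Lemma slice_eq {j : I} (b b' : slice j) : projT1 b = projT1 b' -> b = b'.
Proof.
  destruct b as [i l], b' as [i' l']; cbn; intros e; destruct e.
  apply f_equal, le_is_prop.
Qed.

(** The cone is the total space of [in_cone j] over the slice: membership in the cone implies the
    bound [le i j], which is a proposition. *)
Definition iso_cone_maps (j : I) (Y : Type) :
  iso (forall b : slice j, in_cone j b -> Y) (sierpinski_cone po I (holds j) -> Y).
Proof.
  refine (Iso (fun h x => h (cone_to_slice po j x) (projT2 x))
    (fun k b p => k (existT _ (projT1 b) p)) _ _).
  - intros h; apply ext; intros [i l]; apply ext; intros p.
    exact (f_equal (fun l' : le i j => h (existT _ i l') p) (le_is_prop _ _ _ _)).
  - intros k; apply ext; intros [i p]; reflexivity.
Defined.

Lemma segal_unique_extensions (Y : Type) :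
  based_segal_complete po I Y
  <~> (forall j : I, unique_extensions (in_cone j) (fun _ => Y)).
Proof.
  split; intros H j.
  - apply is_equiv_unique_extensions, (is_equiv_postcompose (iso_cone_maps j Y)), H.
  - apply (is_equiv_postcompose (iso_cone_maps j Y)
      (fun (g : slice j -> Y) b (_ : in_cone j b) => g b)), is_equiv_unique_extensions, H.
Qed.

Lemma in_cone_is_prop (j : I) (b : slice j) : is_prop (in_cone j b).
Proof. apply join_is_prop; intros x y; apply I_is_set. Qed.

(** * Lattice identities and the Phoa formula *)

Context (D : distributive_lattice I) (HP : phoa_principle I).

Lemma meet_I0 (i : I) : meet i I0 = I0.
Proof. rewrite meetC; apply meet0. Qed.

Lemma sup_I0 (i : I) : sup D i I0 = i.
Proof. rewrite <- (meet_I0 i); apply supK. Qed.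

Lemma sup_I1 (i : I) : sup D I1 i = I1.
Proof. rewrite <- (meet1 I (sup D I1 i)); apply meetK. Qed.

Lemma sup_le (i j : I) : le i j -> sup D i j = j.
Proof. intros H; rewrite supC, <- H, (meetC I i j); apply supK. Qed.

(** Both sides agree at the endpoints; at [I1] this uses monotonicity, [f I0] being below [f I1]. *)
Lemma phoa_formula (f : I -> I) (i : I) : f i = sup D (f I0) (meet i (f I1)).
Proof.
  refine (happly f (fun i => sup D (f I0) (meet i (f I1))) (proj2 HP _ _ _ _) i).
  - rewrite meet0, sup_I0; reflexivity.
  - rewrite meet1, sup_le; [reflexivity | apply (proj1 HP), meet0].
Qed.

Definition slice_bot (j : I) : slice j := existT _ I0 (le_I0 I0 j eq_refl).
Definition slice_top (j : I) : slice j := existT _ j (meetI I j).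

Lemma meet_le (i j : I) : le (meet i j) j.
Proof. unfold le; rewrite <- meetA, meetI; reflexivity. Qed.

(** The slice is the retract of the interval along [i |-> meet i j]. *)
Lemma slice_phoa_formula (j : I) (f : slice j -> I) (b : slice j) :
  f b = sup D (f (slice_bot j)) (meet (projT1 b) (f (slice_top j))).
Proof.
  pose proof (phoa_formula (fun i => f (existT _ (meet i j) (meet_le i j))) (projT1 b)) as H.
  cbn beta in H.
  rewrite (slice_eq (existT (fun i => le i j) _ (meet_le (projT1 b) j)) b (projT2 b)) in H.
  rewrite (slice_eq (existT (fun i => le i j) _ (meet_le I0 j)) (slice_bot j) (meet0 I j)) in H.
  rewrite (slice_eq (existT (fun i => le i j) _ (meet_le I1 j)) (slice_top j) (meet1 I j)) in H.
  exact H.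
Qed.

(** * Unique extension for the interval and for partial elements *)

Context (S : internal_sum I) (HS : factors_binary_meets S).

(** Since [holds j] is a proposition, [u] is constant, and [S] is then the meet with [j = I1]. *)
Lemma Sigma_holds (j : I) (u : holds j -> I) (hj : holds j) :
  S (existT (fun i : I => holds i -> I) j u) = u hj.
Proof.
  assert (E : u = fun _ => u hj) by (apply ext; intros h; apply f_equal, I_is_set).
  rewrite (f_equal (fun v => S (existT (fun i : I => holds i -> I) j v)) E), HS.
  transitivity (meet I1 (u hj)); [exact (f_equal (fun i => meet i (u hj)) hj) | apply meet1].
Qed.

(** A map out of the cone is a point [a] together with a partial value [u] at the
    top; its extension is [i |-> sup a (meet i (S (j, u)))]. *)
Lemma unique_extensions_interval (j : I) : unique_extensions (in_cone j) (fun _ => I).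
Proof.
  intros h.
  pose (a := h (slice_bot j) (join_inl po eq_refl)).
  pose (u := fun hj : holds j => h (slice_top j) (join_inr po hj)).
  pose (z := fun b : slice j =>
    sup D a (meet (projT1 b) (S (existT (fun i : I => holds i -> I) j u)))).
  assert (zE : forall b p, z b = h b p).
  { intros b p; refine (join_rec_prop po (z b = h b p) (I_is_set I _ _) _ _ p).
    - intros e; pose proof (slice_eq b (slice_bot j) e) as E; clear e; subst b.
      rewrite (in_cone_is_prop _ _ p (join_inl po eq_refl)).
      unfold z; cbn; rewrite meet0; apply sup_I0.
    (* When [j] holds, the whole slice lies in the cone, so [h] is a total map and obeys the slice
       formula. *)
    - intros hj; rewrite (in_cone_is_prop _ _ p (join_inr po hj)).
      rewrite (slice_phoa_formula j (fun b => h b (join_inr po hj)) b).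
      unfold z; rewrite (Sigma_holds j u hj); unfold a.
      rewrite (in_cone_is_prop j (slice_bot j) (join_inl po eq_refl) (join_inr po hj)).
      reflexivity. }
  exists (fun b => existT _ (z b) (zE b)); intros s; apply ext; intros b.
  (* For any extension [s], [u] is constant at the value of [s] at the top, so [S] gives the meet of
     [j] with it; that [j] is absorbed because [projT1 b] is below [j]. *)
  assert (E : z b = projT1 (s b)).
  { rewrite (slice_phoa_formula j (fun b => projT1 (s b)) b); unfold z, a.
    rewrite (projT2 (s (slice_bot j)) (join_inl po eq_refl)).
    assert (Eu : u = fun _ => projT1 (s (slice_top j))).
    { apply ext; intros hj; symmetry; apply (projT2 (s (slice_top j))). }
    rewrite Eu, HS, (meetA I (projT1 b) j).
    do 2 f_equal; exact (projT2 b). }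
  destruct (s b) as [y e]; cbn in E; destruct E; apply f_equal, prop_pi.
  intros p; apply I_is_set.
Qed.

Lemma unique_extensions_L (T : truncations) (HD : disjunction_property T D) (X : Type) (j : I) :
  unique_extensions (in_cone j) (fun _ => X) <~> unique_extensions (in_cone j) (fun _ => L I X).
Proof.
  pose proof (unique_extensions_sigma (fun _ (i : I) => holds i -> X)
    (unique_extensions_interval j)) as HL.
  split; intros H.
  - apply (snd HL); intros f.
    apply (unique_extensions_exp (R := holds (f (slice_bot j))) T); [| | | |exact H].
    + intros x y; apply I_is_set.
    + intros b x y; apply I_is_set.
    + intros r b; rewrite (slice_phoa_formula j f b), r; apply sup_I1.
    + intros b q; rewrite (slice_phoa_formula j f b) in q.
      refine (tr_rec _ (T _) _ (tr_is_prop _ _) _ (fst (HD _ _) q)).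
      intros [r | e]; apply tr; [left; exact r | right].
      (* A meet equal to [I1] forces its factor [projT1 b] to be [I1]; then [j], lying above it, is
         [I1] too, and [b] is in the cone. *)
      assert (b1 : projT1 b = I1).
      { unfold holds in e; rewrite <- (meet1 I (projT1 b)), <- e.
        rewrite (meetC I (meet _ _)), meetA, meetI; reflexivity. }
      apply join_contr_r; [apply I_is_set|].
      transitivity (meet (projT1 b) j); [rewrite b1, meet1; reflexivity|].
      exact (eq_trans (projT2 b) b1).
  (* For the constant map at [I1] the exponent [holds I1] is inhabited by reflexivity, and the power
     is [X] itself. *)
  - exact (unique_extensions_contr_exp (I_is_set I _ _) eq_refl (fst HL H (fun _ => I1))).
Qed.

End Interval.

End FunctionExtensionality.

Theorem theoremV12 (fe : funext) (po : pushouts) (T : truncations)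
    (I : interval) (HI : consistent I)
    (D : distributive_lattice I) (HD : disjunction_property T D)
    (HP : phoa_principle I)
    (S : internal_sum I) (HS : factors_binary_meets S) (X : Type) :
  based_segal_complete po I X <~> based_segal_complete po I (L I X).
Proof.
  split; intros H; apply (segal_unique_extensions fe po); intros j;
    apply (unique_extensions_L fe po D HP S HS T HD X j);
    apply (segal_unique_extensions fe po); exact H.
Qed.
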